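(* Let $(M_n)_{n\in\mathbb{N}_0}$ be a log-convex sequence of positive real numbers. Then the following are equivalent: (i) the class $C\{M_n\}$ is quasi-analytic; (ii) for some $k\in\mathbb{N}_0$ the class $C\{M_{n+k}\}$ is quasi-analytic; (iii) for every $k\in\mathbb{N}_0$ the class $C\{M_{n+k}\}$ is quasi-analytic.
   Context: $\mathbb{N}_0$ is the set of non-negative integers. A sequence $(M_n)_{n\in\mathbb{N}_0}$ of positive reals is log-convex if $M_n^2\le M_{n-1}M_{n+1}$ for all $n\ge1$. For a sequence $(M_n)_{n\in\mathbb{N}_0}$ of positive reals, $C\{M_n\}$ is the set of all real valued $f\in\mathcal{C}^\infty(\mathbb{R})$ for which there are constants $\beta_f,B_f>0$ (depending only on $f$) with $\sup_{x\in\mathbb{R}}|D^nf(x)|\le\beta_fB_f^nM_n$ for all $n\in\mathbb{N}_0$. The class $C\{M_n\}$ is quasi-analytic if $f\in C\{M_n\}$ and $(D^nf)(0)=0$ for all $n\in\mathbb{N}_0$ imply $f(x)=0$ for all $x\in\mathbb{R}$. $C\{M_{n+k}\}$ is the class associated to the shifted sequence $(M_{n+k})_{n\in\mathbb{N}_0}$. *)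

(* Defs.v *)
From Stdlib Require Import Reals.
From Coquelicot Require Import Coquelicot.
Open Scope R_scope.

Definition log_convex (M : nat -> R) : Prop :=
  forall n : nat, (1 <= n)%nat -> M n ^ 2 <= M (n - 1)%nat * M (n + 1)%nat.

(* [ex_derive_n f n x] only speaks about the last differentiation step at [x];
   quantifying over all [n] and [x] makes it f in C^oo(R). *)
Definition smooth (f : R -> R) : Prop :=
  forall (n : nat) (x : R), ex_derive_n f n x.

Definition sup_abs (g : R -> R) : Rbar :=
  Lub_Rbar (fun y : R => exists x : R, y = Rabs (g x)).

Definition Cclass (M : nat -> R) (f : R -> R) : Prop :=
  smooth f /\
  exists beta B : R, 0 < beta /\ 0 < B /\
    forall n : nat, Rbar_le (sup_abs (Derive_n f n)) (beta * B ^ n * M n).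

Definition quasi_analytic (C : (R -> R) -> Prop) : Prop :=
  forall f : R -> R,
    C f -> (forall n : nat, Derive_n f n 0 = 0) -> forall x : R, f x = 0.

Definition shift (k : nat) (M : nat -> R) : nat -> R :=
  fun n : nat => M (n + k)%nat.

(* Main.v *)
(** Passing from [M] to its shift by one suffices.  If the shifted class is
    quasi-analytic and [f] in [C{M_n}] is flat at 0, then [f'] vanishes.
    Conversely, a flat [f] in [C{M_{n+1}}] has the antiderivative
    [F x = int_0^x f], whose derivatives obey the [C{M_n}] bounds, but which may
    grow linearly.  Since [F] is flat at 0, the function equal to
    [exp (- x) * F x] for [x > 0] and to [0] for [x <= 0] is smooth, bounded and
    flat, and log-convexity ([M (n+1) >= (M 1 / M 0) * M n]) puts it in [C{M_n}].
    Hence [F], and so [f], vanishes for [x > 0]; negative [x] follow by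
    reflection.  *)

Require Import Defs.
From Stdlib Require Import Reals Lra Lia.
From Coquelicot Require Import Coquelicot.
Open Scope R_scope.

(** * Smooth functions as explicit sequences of derivatives *)

(** Carrying all derivatives as one explicit family lets glued, damped, integrated and reflected
    functions be handled by formulas instead of by computing [Derive_n]. *)
Definition derivative_chain (g : nat -> R -> R) : Prop :=
  forall (n : nat) (x : R), is_derive (g n) x (g (S n) x).

Lemma Derive_n_chain (g : nat -> R -> R) :
  derivative_chain g -> forall (n : nat) (x : R), Derive_n (g 0%nat) n x = g n x.
Proof.
  intros Hg n; induction n as [|n IH]; intros x; [reflexivity|].
  simpl; rewrite (Derive_ext _ (g n)) by apply IH.
  now apply is_derive_unique.
Qed.

Lemma smooth_chain (g : nat -> R -> R) : derivative_chain g -> smooth (g 0%nat).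
Proof.
  intros Hg [|n] x; [exact I|].
  apply (ex_derive_ext (g n)).
  - intros t; symmetry; now apply Derive_n_chain.
  - exists (g (S n) x); apply Hg.
Qed.

Lemma chain_Derive_n (f : R -> R) : smooth f -> derivative_chain (Derive_n f).
Proof.
  intros Hf n x; apply Derive_correct; exact (Hf (S n) x).
Qed.

Lemma sup_abs_le (g : R -> R) (c : R) :
  Rbar_le (sup_abs g) c <-> forall x : R, Rabs (g x) <= c.
Proof.
  unfold sup_abs.
  destruct (Lub_Rbar_correct (fun y : R => exists x : R, y = Rabs (g x))) as [Hub Hlub].
  split.
  - intros H x.
    exact (Rbar_le_trans _ _ _ (Hub _ (ex_intro _ x eq_refl)) H).
  - intros H; apply Hlub; intros y [x ->]; apply H.
Qed.

Lemma Cclass_chain (M : nat -> R) (g : nat -> R -> R) (beta B : R) :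
  derivative_chain g -> 0 < beta -> 0 < B ->
  (forall (n : nat) (x : R), Rabs (g n x) <= beta * B ^ n * M n) ->
  Cclass M (g 0%nat).
Proof.
  intros Hg Hbeta HB Hle; split; [now apply smooth_chain|].
  exists beta, B; repeat split; auto.
  intros n; apply sup_abs_le; intros x.
  now rewrite Derive_n_chain.
Qed.

Lemma quasi_analytic_chain (M : nat -> R) (g : nat -> R -> R) (beta B : R) :
  quasi_analytic (Cclass M) ->
  derivative_chain g -> 0 < beta -> 0 < B ->
  (forall (n : nat) (x : R), Rabs (g n x) <= beta * B ^ n * M n) ->
  (forall n : nat, g n 0 = 0) ->
  forall x : R, g 0%nat x = 0.
Proof.
  intros Hqa Hg Hbeta HB Hle H0; apply Hqa.
  - now apply (Cclass_chain M g beta B).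
  - intros n; now rewrite Derive_n_chain.
Qed.

(** * Gluing with zero and damping by [exp (- x)] *)

Definition glue (h : R -> R) (x : R) : R := if Rle_dec x 0 then 0 else h x.

(** At 0 the difference quotient is 0 on the left and that of [h] on the right, and the latter tends
    to [h' 0 = 0]. Applied at every level, this keeps a flat chain a chain after gluing. *)
Lemma is_derive_glue (h h' : R -> R) :
  (forall x : R, is_derive h x (h' x)) -> h 0 = 0 -> h' 0 = 0 ->
  forall x : R, is_derive (glue h) x (glue h' x).
Proof.
  intros Hd H0 H0' x.
  destruct (Rtotal_order x 0) as [Hx|[->|Hx]].
  - apply (is_derive_ext_loc (fun _ => 0)).
    + apply (filter_imp (fun y => y < 0)); [|now apply open_lt].
      intros y Hy; unfold glue; destruct (Rle_dec y 0); lra.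
    + unfold glue; destruct (Rle_dec x 0); [|lra].
      apply (is_derive_const (V := R_NormedModule)).
  - unfold glue at 2; destruct (Rle_dec 0 0); [|lra].
    specialize (Hd 0); rewrite H0' in Hd; apply is_derive_Reals in Hd.
    apply is_derive_Reals; intros eps Heps.
    destruct (Hd eps Heps) as [d Hdl]; exists d; intros t Ht Htd.
    specialize (Hdl t Ht Htd); rewrite H0 in Hdl.
    unfold glue; destruct (Rle_dec 0 0); [|lra].
    destruct (Rle_dec (0 + t) 0); [|exact Hdl].
    replace ((0 - 0) / t - 0) with 0 by (field; exact Ht).
    now rewrite Rabs_R0.
  - apply (is_derive_ext_loc h).
    + apply (filter_imp (fun y => 0 < y)); [|now apply open_gt].
      intros y Hy; unfold glue; destruct (Rle_dec y 0); lra.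
    + unfold glue; destruct (Rle_dec x 0); [lra|apply Hd].
Qed.

(* [exp_twist u n m] is [(D - 1)^n] applied to [u m], where [D (u m) = u (S m)];
   it is the [n]-th derivative of [exp (- x) * u m x] up to the factor [exp (- x)]. *)
Fixpoint exp_twist (u : nat -> R -> R) (n m : nat) (x : R) : R :=
  match n with
  | O => u m x
  | S n => exp_twist u n (S m) x - exp_twist u n m x
  end.

Lemma is_derive_exp_twist (u : nat -> R -> R) :
  derivative_chain u ->
  forall (n m : nat) (x : R), is_derive (exp_twist u n m) x (exp_twist u n (S m) x).
Proof.
  intros Hu n; induction n as [|n IH]; intros m x; [apply Hu|].
  simpl; apply (is_derive_minus (V := R_NormedModule)); apply IH.
Qed.

Lemma exp_twist_0 (u : nat -> R -> R) :
  (forall n : nat, u n 0 = 0) -> forall n m : nat, exp_twist u n m 0 = 0.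
Proof.
  intros Hu n; induction n as [|n IH]; intros m; simpl; [apply Hu|].
  rewrite !IH; ring.
Qed.

Lemma is_derive_exp_opp_mult (v : R -> R) (x l : R) :
  is_derive v x l ->
  is_derive (fun y => exp (- y) * v y) x (exp (- x) * (l - v x)).
Proof.
  intros Hv.
  auto_derive; [now exists l|].
  change (Derive (fun y : R => v y) x) with (Derive v x).
  rewrite (is_derive_unique _ _ _ Hv); ring.
Qed.

(** Each twist adds a term one level up, costing a factor [B], and a term at the same level, costing
    [r] because [M n <= r * M (S n)]; hence [B + r] per step. The point [x] is fixed, so the bound
    can be used on a half-line alone. *)
Lemma exp_twist_bound (M : nat -> R) (u : nat -> R -> R) (beta B r x : R) :
  0 < beta -> 0 < B -> 0 < r ->
  (forall n : nat, M n <= r * M (S n)) ->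
  (forall m : nat, Rabs (exp (- x) * u m x) <= beta * B ^ m * M m) ->
  forall n m : nat,
    Rabs (exp (- x) * exp_twist u n m x) <= beta * (B + r) ^ n * B ^ m * M (n + m)%nat.
Proof.
  intros Hbeta HB Hr HM Hu n; induction n as [|n IH]; intros m; simpl.
  - rewrite Rmult_1_r; apply Hu.
  - rewrite Rmult_minus_distr_l.
    eapply Rle_trans; [apply Rabs_triang|rewrite Rabs_Ropp].
    pose proof (IH (S m)) as H1; pose proof (IH m) as H2.
    replace (n + S m)%nat with (S (n + m)) in H1 by lia; simpl in H1.
    assert (Hc : 0 < beta * (B + r) ^ n * B ^ m).
    { repeat apply Rmult_lt_0_compat; auto; apply pow_lt; lra. }
    pose proof (Rmult_le_compat_l _ _ _ (Rlt_le _ _ Hc) (HM (n + m)%nat)) as H3.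
    nra.
Qed.

(** Log-convexity makes the ratios [M (S n) / M n] nondecreasing, so each is at least the first
    one. *)
Lemma log_convex_ratio (M : nat -> R) :
  (forall n : nat, 0 < M n) -> log_convex M ->
  forall n : nat, M n <= M 0%nat / M 1%nat * M (S n).
Proof.
  intros Hpos Hlc n.
  assert (H : M n * M 1%nat <= M 0%nat * M (S n)).
  { induction n as [|n IH]; [lra|].
    pose proof (Hlc (S n) ltac:(lia)) as H.
    replace (S n - 1)%nat with n in H by lia.
    replace (S n + 1)%nat with (S (S n)) in H by lia.
    pose proof (Hpos n); pose proof (Hpos 1%nat); pose proof (Hpos (S n)) as Hn.
    pose proof (Hpos (S (S n))).
    (* After multiplying by [M (S n)], log-convexity bounds [M (S n) ^ 2] by [M n * M (S (S n))],
       and the induction hypothesis bounds [M n * M 1]. *)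
    apply (Rmult_le_reg_l _ _ _ Hn).
    apply Rle_trans with (M n * M (S (S n)) * M 1%nat); [nra|].
    replace (M n * M (S (S n)) * M 1%nat) with (M n * M 1%nat * M (S (S n))) by ring.
    nra. }
  pose proof (Hpos 1%nat) as H1.
  apply (Rmult_le_reg_r _ _ _ H1).
  replace (M 0%nat / M 1%nat * M (S n) * M 1%nat) with (M 0%nat * M (S n)) by (field; lra).
  exact H.
Qed.

Lemma mult_exp_opp_le_1 (x : R) : 0 <= x -> exp (- x) * x <= 1.
Proof.
  intros Hx; pose proof (exp_pos (- x)).
  replace 1 with (exp (- x) * exp x)
    by (rewrite <- exp_plus, Rplus_opp_l; apply exp_0).
  apply Rmult_le_compat_l; [lra|].
  pose proof (exp_ineq1_le x); lra.
Qed.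

(** * Antiderivatives and vanishing on the positive half-line *)

(** Level [S n] is [g n], so a bound on [g n] by [M (S n)] becomes a bound matching the level. *)
Definition primitive_chain (g : nat -> R -> R) (n : nat) : R -> R :=
  match n with
  | O => fun x => RInt (g 0%nat) 0 x
  | S n => g n
  end.

Lemma derivative_chain_primitive (g : nat -> R -> R) :
  derivative_chain g -> derivative_chain (primitive_chain g).
Proof.
  intros Hg [|n] x; [|apply Hg]; simpl.
  assert (Hc : forall y, continuous (g 0%nat) y).
  { intros y; apply (ex_derive_continuous (V := R_NormedModule)); eexists; apply Hg. }
  apply (is_derive_RInt (V := R_NormedModule) (g 0%nat) _ 0 x); [|apply Hc].
  apply filter_forall; intros y.
  apply (RInt_correct (V := R_CompleteNormedModule)).
  apply (ex_RInt_continuous (V := R_CompleteNormedModule)); auto.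
Qed.

Lemma primitive_chain_0 (g : nat -> R -> R) :
  (forall n : nat, g n 0 = 0) -> forall n : nat, primitive_chain g n 0 = 0.
Proof.
  intros H0 [|n]; [|apply H0].
  apply (RInt_point (V := R_CompleteNormedModule)).
Qed.

Lemma primitive_le (g : nat -> R -> R) (c x : R) :
  derivative_chain g -> (forall y : R, Rabs (g 0%nat y) <= c) -> 0 <= x ->
  Rabs (primitive_chain g 0 x) <= x * c.
Proof.
  intros Hg Hc Hx; simpl.
  replace (x * c) with ((x - 0) * c) by ring.
  apply abs_RInt_le_const; auto.
  apply (ex_RInt_continuous (V := R_CompleteNormedModule)); intros y _.
  apply (ex_derive_continuous (V := R_NormedModule)); eexists; apply Hg.
Qed.

(** The factor [exp (- x)] tames the antiderivative only to the right of 0, hence the restriction to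
    [0 < x]. *)
Lemma flat_chain_pos (M : nat -> R) (g : nat -> R -> R) (beta B : R) :
  (forall n : nat, 0 < M n) -> log_convex M ->
  quasi_analytic (Cclass M) ->
  derivative_chain g -> 0 < beta -> 0 < B ->
  (forall (n : nat) (x : R), Rabs (g n x) <= beta * B ^ n * M (S n)) ->
  (forall n : nat, g n 0 = 0) ->
  forall x : R, 0 < x -> g 0%nat x = 0.
Proof.
  intros Hpos Hlc Hqa Hg Hbeta HB Hle H0.
  set (u := primitive_chain g).
  (* The summand [beta / B] absorbs the index shift at levels [S m]; [beta * M 1 / M 0] rewrites the
     level 0 bound [beta * M 1] as a multiple of [M 0]. *)
  set (c := beta / B + beta * M 1%nat / M 0%nat).
  set (r := M 0%nat / M 1%nat).
  pose proof (Hpos 0%nat) as HM0; pose proof (Hpos 1%nat) as HM1.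
  assert (Hu : derivative_chain u) by now apply derivative_chain_primitive.
  assert (Hr : 0 < r) by now apply Rdiv_lt_0_compat.
  assert (Hc1 : 0 < beta / B) by now apply Rdiv_lt_0_compat.
  assert (Hc2 : 0 < beta * M 1%nat / M 0%nat) by (apply Rdiv_lt_0_compat; nra).
  assert (Hc : 0 < c) by (unfold c; lra).
  assert (Hub : forall x, 0 < x -> forall m : nat,
             Rabs (exp (- x) * u m x) <= c * B ^ m * M m).
  { intros x Hx m; pose proof (exp_pos (- x)) as He.
    rewrite Rabs_mult, (Rabs_pos_eq (exp (- x))) by lra.
    destruct m as [|m].
    (* Level 0: the linear growth [x * (beta * M 1)] is cancelled by [exp (- x) * x <= 1]. *)
    - pose proof (primitive_le g (beta * M 1%nat) x Hg) as HF.
      specialize (HF ltac:(intros y; specialize (Hle 0%nat y); simpl in Hle; lra)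
                     ltac:(lra)).
      pose proof (mult_exp_opp_le_1 x ltac:(lra)) as H1.
      apply Rle_trans with (beta * M 1%nat).
      + unfold u; apply Rle_trans with (exp (- x) * x * (beta * M 1%nat)).
        * rewrite Rmult_assoc; apply Rmult_le_compat_l; lra.
        * rewrite <- (Rmult_1_l (beta * M 1%nat)) at 2.
          apply Rmult_le_compat_r; nra.
      + replace (beta * M 1%nat) with (beta * M 1%nat / M 0%nat * M 0%nat)
          by (field; lra).
        simpl; rewrite Rmult_1_r.
        apply Rmult_le_compat_r; unfold c; lra.
    - apply Rle_trans with (Rabs (g m x)).
      + pose proof (Rabs_pos (g m x)).
        assert (exp (- x) < 1) by (rewrite <- exp_0; apply exp_increasing; lra).
        simpl; nra.
      + eapply Rle_trans; [apply Hle|].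
        replace (beta * B ^ m) with (beta / B * B ^ S m) by (simpl; field; lra).
        apply Rmult_le_compat_r; [apply Rlt_le, Hpos|].
        apply Rmult_le_compat_r; [apply pow_le; lra|unfold c; lra]. }
  set (h := fun (n : nat) (x : R) => exp (- x) * exp_twist u n 0 x).
  assert (Hh0 : forall n, h n 0 = 0).
  { intros n; unfold h; rewrite exp_twist_0; [ring|].
    now apply primitive_chain_0. }
  assert (Hh : derivative_chain h).
  { intros n x; apply is_derive_exp_opp_mult; now apply is_derive_exp_twist. }
  assert (HF : forall x, glue (h 0%nat) x = 0).
  { apply (quasi_analytic_chain M (fun n => glue (h n)) c (B + r)); auto; try lra.
    - intros n; now apply is_derive_glue.
    - intros n x; unfold glue; destruct (Rle_dec x 0) as [Hx|Hx].
      + rewrite Rabs_R0; apply Rlt_le; repeat apply Rmult_lt_0_compat; auto.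
        apply pow_lt; lra.
      + pose proof (exp_twist_bound M u c B r x Hc HB Hr
          (log_convex_ratio M Hpos Hlc) (Hub x ltac:(lra)) n 0) as H.
        rewrite Nat.add_0_r, Rmult_1_r in H; exact H.
    - intros n; unfold glue; destruct (Rle_dec 0 0); lra. }
  intros x Hx.
  (* The antiderivative vanishes on a neighbourhood of [x], so its derivative [g 0 x] is 0. *)
  assert (Hd : is_derive (u 0%nat) x 0).
  { apply (is_derive_ext_loc (fun _ => 0)); [|apply (is_derive_const (V := R_NormedModule))].
    apply (filter_imp (fun y => 0 < y)); [|now apply open_gt].
    intros y Hy; specialize (HF y); unfold glue, h in HF; simpl in HF.
    destruct (Rle_dec y 0); [lra|].
    apply Rmult_integral in HF as [HF|HF]; [|exact (eq_sym HF)].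
    pose proof (exp_pos (- y)); lra. }
  rewrite <- (is_derive_unique _ _ _ Hd); symmetry.
  apply is_derive_unique, (Hu 0%nat).
Qed.

(** * Reflection and the shift by one *)

Lemma derivative_chain_reflect (g : nat -> R -> R) :
  derivative_chain g -> derivative_chain (fun n x => (-1) ^ n * g n (- x)).
Proof.
  intros Hg n x.
  replace ((-1) ^ S n * g (S n) (- x)) with ((-1) ^ n * (-1 * g (S n) (- x)))
    by (simpl; ring).
  apply is_derive_scal.
  apply (is_derive_comp (V := R_NormedModule) (g n) Ropp); [apply Hg|].
  auto_derive; auto; ring.
Qed.

Lemma Derive_n_Cclass_le (M : nat -> R) (f : R -> R) :
  Cclass M f ->
  exists beta B : R, 0 < beta /\ 0 < B /\
    forall (n : nat) (x : R), Rabs (Derive_n f n x) <= beta * B ^ n * M n.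
Proof.
  intros [_ (beta & B & Hbeta & HB & H)]; exists beta, B; repeat split; auto.
  intros n; now apply sup_abs_le.
Qed.

(** [N] is tied to [M] by a pointwise equation because [shift (S k) M n] and [shift k M (S n)] are
    equal but not convertible. *)
Lemma quasi_analytic_succ (M N : nat -> R) :
  (forall n : nat, 0 < M n) -> log_convex M -> (forall n : nat, N n = M (S n)) ->
  quasi_analytic (Cclass M) -> quasi_analytic (Cclass N).
Proof.
  intros Hpos Hlc HN Hqa f Hf H0 x.
  pose proof (chain_Derive_n f (proj1 Hf)) as Hch.
  destruct (Derive_n_Cclass_le N f Hf) as (beta & B & Hbeta & HB & Hle).
  destruct (Rtotal_order x 0) as [Hx|[->|Hx]]; [|exact (H0 0%nat)|].
  (* For negative [x], the reflected function satisfies the same bounds and is evaluated at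
     [- x]. *)
  - pose proof (flat_chain_pos M (fun n y => (-1) ^ n * Derive_n f n (- y)) beta B
      Hpos Hlc Hqa (derivative_chain_reflect _ Hch) Hbeta HB) as H.
    specialize (H ltac:(intros n y; cbv beta; rewrite Rabs_mult, pow_1_abs, Rmult_1_l, <- HN;
                        apply Hle)
                  ltac:(intros n; cbv beta; rewrite Ropp_0, H0; ring)
                  (- x) ltac:(lra)).
    simpl in H; rewrite Ropp_involutive in H; lra.
  - apply (flat_chain_pos M (Derive_n f) beta B); auto.
    intros n y; rewrite <- HN; apply Hle.
Qed.

(** The bounds [beta * B ^ S n * M (S n)] put the derivative of [f] in the class of [N] with
    constant [beta * B]. It is flat, hence zero, and the mean value theorem makes [f] constant. *)
Lemma quasi_analytic_pred (M N : nat -> R) :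
  (forall n : nat, N n = M (S n)) ->
  quasi_analytic (Cclass N) -> quasi_analytic (Cclass M).
Proof.
  intros HN Hqa f Hf H0 x.
  pose proof (chain_Derive_n f (proj1 Hf)) as Hch.
  destruct (Derive_n_Cclass_le M f Hf) as (beta & B & Hbeta & HB & Hle).
  assert (Hd : forall y, Derive_n f 1 y = 0).
  { apply (quasi_analytic_chain N (fun n => Derive_n f (S n)) (beta * B) B); auto.
    - intros n; apply Hch.
    - now apply Rmult_lt_0_compat.
    - intros n y; rewrite HN, (Rmult_assoc beta B); apply (Hle (S n)). }
  destruct (MVT_gen f 0 x (fun _ => 0)) as (y & _ & Hy).
  - intros y _; rewrite <- (Hd y); apply (Hch 0%nat).
  - intros y _; apply continuity_pt_filterlim.
    apply (ex_derive_continuous (V := R_NormedModule)); eexists; apply (Hch 0%nat).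
  - pose proof (H0 0%nat) as Hf0; simpl in Hf0; lra.
Qed.

(** * Shifts by an arbitrary [k] *)

Lemma log_convex_shift (k : nat) (M : nat -> R) :
  log_convex M -> log_convex (shift k M).
Proof.
  intros H n Hn; unfold shift.
  replace (n - 1 + k)%nat with (n + k - 1)%nat by lia.
  replace (n + 1 + k)%nat with (n + k + 1)%nat by lia.
  apply H; lia.
Qed.

(** Comparing every shift with the unshifted class handles both quantifiers over [k] at once. The
    induction applies the one-step results to [shift k M], again positive and log-convex. *)
Lemma quasi_analytic_shift (M : nat -> R) (k : nat) :
  (forall n : nat, 0 < M n) -> log_convex M ->
  quasi_analytic (Cclass M) <-> quasi_analytic (Cclass (shift k M)).
Proof.
  intros Hpos Hlc.
  assert (HS : forall j n : nat, shift (S j) M n = shift j M (S n)).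
  { intros j n; unfold shift; f_equal; lia. }
  assert (H0 : forall n : nat, shift 0 M n = M n).
  { intros n; unfold shift; f_equal; lia. }
  induction k as [|k IH].
  (* [shift 0 M n] is [M (n + 0)], equal to [M n] only propositionally, so membership is transferred
     through the bounds. *)
  - split; intros Hqa f [Hf (beta & B & Hbeta & HB & Hle)]; apply Hqa;
      (split; [exact Hf|exists beta, B; repeat split; auto]);
      intros n; [rewrite <- H0|rewrite H0]; apply Hle.
  - rewrite IH; split.
    + apply quasi_analytic_succ; [intros n; apply Hpos|now apply log_convex_shift|apply HS].
    + apply quasi_analytic_pred, HS.
Qed.

Theorem lemma4p5 (M : nat -> R) (M_pos : forall n : nat, 0 < M n)
    (M_log_convex : log_convex M) :
  (quasi_analytic (Cclass M) <->
     exists k : nat, quasi_analytic (Cclass (shift k M))) /\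
  ((exists k : nat, quasi_analytic (Cclass (shift k M))) <->
     forall k : nat, quasi_analytic (Cclass (shift k M))).
Proof.
  pose proof (fun k => quasi_analytic_shift M k M_pos M_log_convex) as H.
  split; split.
  - intros Hqa; exists 0%nat; now apply H.
  - intros [k Hk]; now apply (H k).
  - intros [k Hk] j; apply H; now apply (H k).
  - intros Hall; exists 0%nat; apply Hall.
Qed.
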